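(* Let $a\ge b\ge c\ge 1$ be integers with $b\ge 2$, and let $n=a+b+c-1$. Then \[X_{\theta_{abc}}=\sum_{I\vDash n}c'_I\,w_I\,e_I,\qquad c'_I=\sum_{k=2}^{c}\Theta_I^+(k)-\sum_{k=a}^{a+c-2}\Theta^-_{\overline{\varphi(I)}}(k)+\Delta_I(b+c-1),\] where the sum runs over all compositions $I$ of $n$.
   Context: $X_G$ denotes the chromatic symmetric function $\sum_\kappa\prod_{v}x_{\kappa(v)}$ over proper colorings $\kappa\colon V(G)\to\{1,2,\dots\}$. The theta graph $\theta_{abc}$ consists of two distinct vertices joined by three internally disjoint paths of lengths $a,b,c$; it has $a+b+c-1$ vertices. A composition $I=i_1\cdots i_z\vDash n$ is a sequence of positive integers with sum $|I|=n$; $\overline I=i_z\cdots i_1$; $|i_1\cdots i_k|=i_1+\dots+i_k$. $e_I=e_{i_1}\cdots e_{i_z}$ (elementary symmetric functions), $w_I=i_1(i_2-1)\cdots(i_z-1)$. $\Theta_I^+(x)=\min\{|i_1\cdots i_k|:0\le k\le z,\ |i_1\cdots i_k|\ge x\}-x$ and $\Theta_I^-(x)=x-\max\{|i_1\cdots i_k|:0\le k\le z,\ |i_1\cdots i_k|\le x\}$. $e_2(x_1,\dots,x_m)=\sum_{i<j}x_ix_j$. For $1\le m\le n-1$ define $p,s,q,t$ by $m=i_1+\dots+i_{p-1}+s=i_2+\dots+i_q+t$ with $1\le p,q\le z$, $1\le s\le i_p$, $1\le t\le i_{q+1}$, where $i_{z+1}=i_1$; $\Delta_I(m)=s(i_p-s-i_1)$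 if $i_1\le i_p-s$, else $\Delta_I(m)=e_2(i_p-s,i_{p+1},\dots,i_q,t)$. The map $\varphi$ (depending on $a$): write $I=PQ$ where $Q$ is the shortest suffix of $I$ with $|Q|\ge a$; if $Q=I$ then $\varphi(I)=I$; otherwise $\varphi(I)=i_1\,\overline{P\backslash i_1}\,Q$, where $P\backslash i_1$ is $P$ with its first part $i_1$ removed. *)

(* Defs.v *)
From HB Require Import structures.
From mathcomp Require Import all_boot all_order all_algebra finmap.
From mathcomp Require Import mathcomp_extra boolp classical_sets functions.
From mathcomp Require Import cardinality fsbigop.
From mathcomp Require Import monalg.

Set Implicit Arguments.
Unset Strict Implicit.
Unset Printing Implicit Defensive.

Import GRing.Theory Num.Theory.

Local Open Scope nat_scope.
Local Open Scope classical_set_scope.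
Local Open Scope ring_scope.

(* Formal power series with integer coefficients in countably many variables,
   given by their coefficient functions.  The index i : nat stands for the
   (i+1)-st variable (or colour).  Addition is the pointwise one inherited from
   functions; multiplication is [psmul], NOT the pointwise product that the
   function type also carries. *)
Definition series : Type := {cmonom nat} -> int.

Definition ps1 : series := fun m => (m == mone)%:R.

Definition psmul (f g : series) : series := fun m =>
  \sum_(d \in [set d : {cmonom nat} * {cmonom nat} | mmul d.1 d.2 = m])
     f d.1 * g d.2.

(* The formal sum of the monomials x t over t \in A; it is only used when each
   monomial arises from finitely many t. *)
Definition monomial_sum (T : choiceType) (A : set T) (x : T -> {cmonom nat}) :
    series :=
  fun m => \sum_(t \in A `&` [set t | x t = m]) (1 : int).

Definition elem (k : nat) : series :=
  monomial_sum [set S : {fset nat} | #|` S| = k]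
    (fun S => \big[mmul/mone]_(i <- S) ucm i).

Definition elemI (I : seq nat) : series := \big[psmul/ps1]_(i <- I) elem i.

Definition proper_coloring (V : finType) (adj : rel V) (kappa : {ffun V -> nat}) :=
  forall u v : V, adj u v -> kappa u <> kappa v.

Definition chromsym (V : finType) (adj : rel V) : series :=
  monomial_sum [set kappa | proper_coloring adj kappa]
    (fun kappa => \big[mmul/mone]_(v : V) ucm (kappa v)).

Section Theta.
Local Open Scope nat_scope.
Variables a b c : nat.

(* The two terminals, followed by the internal vertices of the three paths. *)
Definition theta_vertex : finType :=
  (bool + ('I_a.-1 + ('I_b.-1 + 'I_c.-1)))%type.

Definition theta_path (l : nat) (f : 'I_l.-1 -> theta_vertex) :
    seq theta_vertex :=
  inl false :: rcons [seq f i | i <- enum 'I_l.-1] (inl true).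

Definition theta_paths : seq (seq theta_vertex) :=
  [:: @theta_path a (fun i => inr (inl i));
      @theta_path b (fun i => inr (inr (inl i)));
      @theta_path c (fun i => inr (inr (inr i)))].

Definition consecutive (T : eqType) (s : seq T) : rel T :=
  fun x y => (x, y) \in zip s (behead s).

Definition theta_adj : rel theta_vertex := fun u v =>
  has (fun s => consecutive s u v || consecutive s v u) theta_paths.

End Theta.

Section Compositions.
Local Open Scope nat_scope.
Implicit Types (I L : seq nat) (a b c k m n x : nat).

Definition compositions n : set (seq nat) :=
  [set I | all (leq 1) I /\ sumn I = n].

Definition psum I k := sumn (take k I).

Definition weight I := head 0 I * \prod_(i <- behead I) (i - 1).

(* The default value |I| of the minimum is neutral, since it is the largest
   partial sum; for x <= |I| the minimum ranges over a nonempty set. *)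
Definition Theta_plus I x :=
  \big[minn/sumn I]_(k < (size I).+1 | x <= psum I k) psum I k - x.

Definition Theta_minus I x :=
  x - \max_(k < (size I).+1 | psum I k <= x) psum I k.

Definition e2 (s : seq nat) :=
  \sum_(j < size s) \sum_(i < j) nth 0 s i * nth 0 s j.

(* For 1 <= m <= |L|, the unique p and s with m = l_1 + ... + l_(p-1) + s,
   1 <= p <= size L and 1 <= s <= l_p; see [part_locP] and [part_loc_uniq]. *)
Definition part_index L m := (reshape_index L m.-1).+1.
Definition part_offset L m := (reshape_offset L m.-1).+1.

(* The j-th part of rot 1 I is i_(j+1), with i_(z+1) = i_1, so q and t are the
   location of m in rot 1 I. *)
Definition Delta I m :=
  let p := part_index I m in
  let s := part_offset I m in
  let q := part_index (rot 1 I) m in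
  let t := part_offset (rot 1 I) m in
  let i1 := head 0 I in
  let ip := nth 0 I p.-1 in
  if i1 <= ip - s then s * (ip - s - i1)
  else e2 ((ip - s) :: rcons (take (q - p) (drop p I)) t).

(* The number of parts of P, where I = PQ with Q the shortest suffix of I such
   that |Q| >= a. *)
Definition phi_cut a I := \max_(j < (size I).+1 | a <= sumn (drop j I)) j.

Definition phi a I :=
  if take (phi_cut a I) I is i1 :: P then
    i1 :: rev P ++ drop (phi_cut a I) I
  else I.

Definition theta_coef a b c I : int :=
  (\sum_(2 <= k < c.+1) (Theta_plus I k)%:Z
   - \sum_(a <= k < a + c - 1) (Theta_minus (rev (phi a I)) k)%:Z
   + (Delta I (b + c - 1))%:Z)%R.

End Compositions.

Section SanityChecks.
Local Open Scope nat_scope.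

Lemma card_theta_vertex a b c : 0 < a -> 0 < b -> 0 < c ->
  #|theta_vertex a b c| = a + b + c - 1.
Proof.
move=> a0 b0 c0; rewrite !card_sum card_bool !card_ord.
case: a b c a0 b0 c0 => [|a] [|b] [|c] //= _ _ _.
by rewrite !(addSn, addnS) subn1 !addnA !add0n.
Qed.

Lemma theta_adj_sym a b c : symmetric (@theta_adj a b c).
Proof. by move=> u v; apply: eq_has => s; rewrite orbC. Qed.

Lemma consecutive_irr (T : eqType) (s : seq T) x : uniq s -> ~~ consecutive s x x.
Proof.
rewrite /consecutive; case: s => // y s /=.
elim: s y => //= z s IHs y /andP[+ /IHs IH].
rewrite !inE negb_or => /andP[yz _]; rewrite negb_or xpair_eqE IH andbT.
by apply: contra yz => /andP[/eqP <- /eqP <-].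
Qed.

Lemma theta_path_uniq a b c l (f : 'I_l.-1 -> theta_vertex a b c) :
  injective f -> (forall i t, f i <> inl t) -> uniq (theta_path f).
Proof.
move=> injf fN; rewrite /theta_path /= rcons_uniq map_inj_uniq ?enum_uniq //.
rewrite mem_rcons inE /= andbT; apply/andP; split.
  by apply/mapP => -[i _ /esym /fN].
by apply/mapP => -[i _ /esym /fN].
Qed.

Lemma theta_adj_irr a b c : irreflexive (@theta_adj a b c).
Proof.
move=> u; apply/hasP => -[s]; rewrite !inE orbb.
by case/or3P=> /eqP ->; apply/negP/consecutive_irr/theta_path_uniq => // i j [].
Qed.

Lemma part_locP L m : 0 < m <= sumn L ->
  [/\ 1 <= part_index L m <= size L,
      1 <= part_offset L m <= nth 0 L (part_index L m).-1 &
      m = sumn (take (part_index L m).-1 L) + part_offset L m].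
Proof.
case: m => // m /= ltm; split; first exact: reshape_indexP.
  exact: reshape_offsetP.
by rewrite /part_index /part_offset /= addnS; congr S; rewrite -{1}(reshape_indexK L m).
Qed.

Lemma part_loc_uniq L m p s :
  1 <= p -> 1 <= s <= nth 0 L p.-1 -> m = sumn (take p.-1 L) + s ->
  p = part_index L m /\ s = part_offset L m.
Proof.
case: p => // p _; case: s => // s /= lts ->.
rewrite addnS /part_index /part_offset /=.
by rewrite -/(flatten_index L p s) flatten_indexKl // flatten_indexKr.
Qed.

(* The index sets of the finitely supported sums above are finite, so that none
   of these sums takes the default value 0. *)
Lemma psmul_finite (m : {cmonom nat}) :
  finite_set [set d : {cmonom nat} * {cmonom nat} | mmul d.1 d.2 = m].
Proof.
pose T := {ffun finsupp m -> 'I_(mdeg m).+1}.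
pose F (h : T) : {cmonom nat} := [cmonom (h i : nat) | i : finsupp m]%M.
pose G (h : T * T) := (F h.1, F h.2).
suff FP (d d' : {cmonom nat}) : mmul d d' = m -> exists h, F h = d.
  apply: (@sub_finite_set _ _ (G @` setT)); last first.
    by apply: finite_image; apply: finite_finset.
  move=> [d d'] /= dd'; have [h <-] := FP _ _ dd'.
  have [h' <-] : exists h', F h' = d' by apply: (FP _ d); rewrite mulmC.
  by exists (h, h').
move=> dd'; have le_dm i : d i <= m i by rewrite -dd' cmM leq_addr.
have le_deg i : m i <= mdeg m.
  rewrite mdegE; case: (mdomP m i) => // im.
  by rewrite (big_fsetD1 _ im) leq_addr.
exists [ffun i => inord (d (val i))]; apply/eqP/cmP => i.
rewrite /F cmE fsfun_ffun; case: insubP => [j _ ji|].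
  by rewrite /= ffunE inordK ?ji // ltnS (leq_trans (le_dm _)).
rewrite memNfinsupp => /eqP mi0.
by have := le_dm i; rewrite mi0 leqn0 => /eqP.
Qed.

Lemma chromsym_finite (V : finType) (m : {cmonom nat}) :
  finite_set [set kappa : {ffun V -> nat} |
                \big[mmul/mone]_(v : V) ucm (kappa v) = m].
Proof.
pose F (h : {ffun V -> finsupp m}) := [ffun v => val (h v)].
apply: (@sub_finite_set _ _ (F @` setT)); last first.
  by apply: finite_image; apply: finite_finset.
move=> k /= km; have kP v : k v \in finsupp m.
  by rewrite -km (bigD1 v) //= mdomD in_fsetU mdomU in_fset1 eqxx.
by exists [ffun v => [` kP v]%fset] => //; apply/ffunP => v; rewrite !ffunE.
Qed.

Lemma elem_finite (m : {cmonom nat}) :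
  finite_set [set S : {fset nat} | \big[mmul/mone]_(i <- S) ucm i = m].
Proof.
apply: (@sub_finite_set _ _ [set` fpowerset (finsupp m)]); last first.
  exact: finite_fset.
move=> S /= Sm; rewrite fpowersetE; apply/fsubsetP => i iS.
by rewrite -Sm (big_fsetD1 _ iS) /= mdomD in_fsetU mdomU in_fset1 eqxx.
Qed.

Lemma compositions_finite n : finite_set (compositions n).
Proof.
apply: (@sub_finite_set _ _
  ((fun s : n.-bseq 'I_n.+1 => [seq val i | i <- s]) @` setT)); last first.
  by apply: finite_image; apply: finite_finset.
move=> I /= [I1 <-] {n}.
have sz : size [seq inord i : 'I_(sumn I).+1 | i <- I] <= sumn I.
  rewrite size_map; elim: I I1 => //= i I IHI /andP[i1 /IHI].
  by rewrite -add1n => /(leq_add i1).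
exists (Bseq sz) => //=; rewrite -map_comp map_id_in // => i iI /=.
rewrite inordK // ltnS; elim: I iI {I1 sz} => //= j I IHI.
rewrite inE => /predU1P[->|/IHI]; first exact: leq_addr.
by move/leq_trans; apply; apply: leq_addl.
Qed.

End SanityChecks.

(* Main.v *)
Require Import Defs.
From mathcomp Require Import all_boot all_order all_algebra finmap.
From mathcomp Require Import boolp classical_sets functions cardinality fsbigop.
From mathcomp Require Import monalg.
From mathcomp Require Import zify ring.

(** Fix finitely many colours and substitute elements [x] of a commutative ring
    for the variables.  Counting colourings vertex by vertex (transfer matrices)
    gives the triple-deletion relations
      theta(a,b,c) = theta(a,b+1,c-1) + T(a+b,c-1) - T(a+c-1,b),
      T(m,l) = T(m+1,l-1) + X_(C_m) X_(P_l) - X_(P_(m+l)),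
    where [T(m,l)] is the tadpole with a cycle of length [m] and a tail of length
    [l].  With [X_(P_n)] being the sum of the [w_I e_I], the second relation gives
    [T(m,l)] as the sum of [Theta^+_I(l+1) w_I e_I]: a product [w_I w_J] of weights
    is a weight [w_(JI)] up to a factor, and [JI] runs over the compositions that
    have [|J|] as a partial sum.  The first relation then writes [theta(a,b,c)] as
    a combination of values [Theta^+_I(k)].  Permuting parts of [I] other than the
    first changes neither [w_I] nor [e_I]; this is how [phi] enters, and how the
    values left over when [c = 1] are collected into [Delta]. *)

Set Implicit Arguments.
Unset Strict Implicit.
Unset Printing Implicit Defensive.

Import GRing.Theory Num.Theory.

Local Open Scope nat_scope.

(** * Partial sums of compositions *)

Section ThetaStatistics.
Implicit Types (I L : seq nat) (k x : nat).

Lemma psum_leq I : {homo psum I : j k / j <= k}.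
Proof.
move=> j k jk; rewrite /psum -(subnK jk) addnC takeD sumn_cat; exact: leq_addr.
Qed.

Lemma psum_oversize I k : size I <= k -> psum I k = sumn I.
Proof. by move=> h; rewrite /psum take_oversize. Qed.

Lemma psum_minn I k : psum I (minn k (size I)) = psum I k.
Proof.
by case: (leqP k (size I)) => // /ltnW h; rewrite !psum_oversize.
Qed.

Lemma psum_le_sumn I k : psum I k <= sumn I.
Proof. by rewrite -psum_minn -(psum_oversize (leqnn _)) psum_leq ?geq_minr. Qed.

Lemma bigminn_leq (T : finType) (P : pred T) (F : T -> nat) d j :
  P j -> \big[minn/d]_(i | P i) F i <= F j.
Proof.
move=> Pj; have : j \in index_enum T by rewrite mem_index_enum.
elim: (index_enum T) => // i r IH; rewrite inE big_cons => /predU1P[<-|/IH le].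
  by rewrite Pj geq_minl.
by case: ifP => // _; apply: leq_trans le; apply: geq_minr.
Qed.

(** [k] may be any natural number: partial sums are constant past [size I], so [minn k (size I)] is
    an index within the range of the definition. *)
Lemma Theta_plusE I x k : x <= psum I k ->
  (forall j, x <= psum I j -> psum I k <= psum I j) ->
  Theta_plus I x = psum I k - x.
Proof.
move=> xk kmin; rewrite /Theta_plus; congr (_ - _).
apply/eqP; rewrite eqn_leq; apply/andP; split; last first.
  elim/big_ind: _ => [|i j ki kj|i]; first exact: psum_le_sumn.
    by rewrite leq_min ki.
  exact: kmin.
have lt : minn k (size I) < (size I).+1 by rewrite ltnS geq_minr.
by rewrite -(psum_minn I k) (@bigminn_leq _ _ _ _ (Ordinal lt)) //= psum_minn.
Qed.

Lemma Theta_minusE I x k : psum I k <= x ->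
  (forall j, psum I j <= x -> psum I j <= psum I k) ->
  Theta_minus I x = x - psum I k.
Proof.
move=> xk kmax; rewrite /Theta_minus; congr (_ - _).
apply/eqP; rewrite eqn_leq; apply/andP; split.
  by apply/bigmax_leqP => i; apply: kmax.
have lt : minn k (size I) < (size I).+1 by rewrite ltnS geq_minr.
by rewrite -psum_minn (bigmax_sup (Ordinal lt)) /= ?psum_minn.
Qed.

Lemma Theta_plus_min I x : x <= sumn I ->
  exists2 k, x <= psum I k & forall j, x <= psum I j -> psum I k <= psum I j.
Proof.
move=> xI; have ex : exists k, x <= psum I k.
  by exists (size I); rewrite psum_oversize.
by case: (ex_minnP ex) => k xk kmin; exists k => // j /kmin; apply: psum_leq.
Qed.

Lemma Theta_plus_sumn I : Theta_plus I (sumn I) = 0.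
Proof.
by rewrite (@Theta_plusE I _ (size I)) psum_oversize ?subnn.
Qed.

Lemma Theta_plus_head i I x : 0 < x <= i -> Theta_plus (i :: I) x = i - x.
Proof.
move=> /andP[x0 xi]; rewrite (@Theta_plusE _ x 1) /psum /= ?take0 ?addn0 // => -[|j] /=.
  by move=> /(leq_trans x0).
by rewrite leq_addr.
Qed.

Lemma Theta_plus_behead i I x : 0 < x <= sumn I ->
  Theta_plus (i :: I) (i + x) = Theta_plus I x.
Proof.
move=> /andP[x0 xI]; have [k xk kmin] := Theta_plus_min xI.
rewrite (Theta_plusE xk kmin) (@Theta_plusE _ _ k.+1) /psum /=.
- by rewrite subnDl.
- by rewrite leq_add2l.
by case=> [|j] /=; [lia | rewrite !leq_add2l => /kmin].
Qed.

(** When [x] is not itself a partial sum, the least partial sum above [x] is also the least one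
    above [x.+1]. *)
Lemma Theta_plusS I x : x < sumn I -> 0 < Theta_plus I x ->
  Theta_plus I x = (Theta_plus I x.+1).+1.
Proof.
move=> xI; have [k xk kmin] := Theta_plus_min (ltnW xI).
rewrite (Theta_plusE xk kmin) subn_gt0 => ltxk.
rewrite (@Theta_plusE I x.+1 k) //; first by rewrite subnSK.
by move=> j /ltnW /kmin.
Qed.

Lemma Theta_plus_eq0 I x : x <= sumn I ->
  reflect (exists k, psum I k = x) (Theta_plus I x == 0).
Proof.
move=> xI; apply: (iffP idP) => [|[k kx]].
  have [k xk kmin] := Theta_plus_min xI.
  rewrite (Theta_plusE xk kmin) subn_eq0 => kx; exists k; apply/eqP.
  by rewrite eqn_leq kx.
by rewrite (@Theta_plusE I x k) kx ?subnn.
Qed.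

Lemma psum_rev I k : psum (rev I) k = sumn I - psum I (size I - k).
Proof.
rewrite /psum take_rev sumn_rev.
by rewrite -[in sumn I](cat_take_drop (size I - k) I) sumn_cat addKn.
Qed.

(** The partial sums of [rev I] are the complements in [sumn I] of those of [I], which exchanges
    minima above and maxima below. *)
Lemma Theta_minus_rev I x : x <= sumn I ->
  Theta_minus (rev I) x = Theta_plus I (sumn I - x).
Proof.
move=> xI; have [k xk kmin] := Theta_plus_min (leq_subr x (sumn I)).
have kE : psum (rev I) (size I - minn k (size I)) = sumn I - psum I k.
  by rewrite psum_rev subKn ?geq_minr // psum_minn.
have := psum_le_sumn I k.
rewrite (Theta_plusE xk kmin) (@Theta_minusE _ _ (size I - minn k (size I))) kE; try lia.
move=> j; rewrite psum_rev; have := psum_le_sumn I (size I - j) => h1 h2.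
by have := kmin (size I - j); lia.
Qed.

Lemma Theta_minus_head i I x : x < i -> Theta_minus (i :: I) x = x.
Proof.
move=> xi; rewrite (@Theta_minusE _ x 0) /psum ?take0 ?subn0 // => -[|j] //=.
lia.
Qed.

Lemma Theta_minus_behead i I x : Theta_minus (i :: I) (i + x) = Theta_minus I x.
Proof.
have xI : exists k, [exists j : 'I_(size I).+1, (psum I j == k) && (k <= x)].
  by exists 0; apply/existsP; exists ord0; rewrite /psum take0 /=.
have bd k : [exists j : 'I_(size I).+1, (psum I j == k) && (k <= x)] -> k <= x.
  by case/existsP => j /andP[].
case: (ex_maxnP xI bd) => m /existsP[j /andP[/eqP jm mx]] mmax.
have jmax k : psum I k <= x -> psum I k <= psum I j.
  move=> kx; rewrite jm mmax //; apply/existsP.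
  have lt : minn k (size I) < (size I).+1 by rewrite ltnS geq_minr.
  by exists (Ordinal lt); rewrite /= psum_minn eqxx.
rewrite (@Theta_minusE I x j) ?jm // -?jm // (@Theta_minusE _ _ j.+1) /psum /=.
- by rewrite subnDl.
- by rewrite leq_add2l -/(psum I j) jm.
by case=> [|k] /=; [lia | rewrite !leq_add2l => /jmax].
Qed.

(** * Sums of the statistics over initial ranges, and [Delta] *)

Lemma bin2D x y : 'C(x + y, 2) = 'C(x, 2) + 'C(y, 2) + x * y.
Proof.
by elim: y => [|y IH]; [rewrite muln0 !addn0 | rewrite addnS !binS !bin1 IH mulnS; lia].
Qed.

(** Along a full part [i] the statistic takes the values [i - 1, ..., 0], with sum ['C(i, 2)]. The
    binomial on the left restores the values omitted by stopping [s] steps into a part. *)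
Lemma sum_Theta_plus L p s : p < size L -> 0 < s <= nth 0 L p ->
  (\sum_(1 <= k < (psum L p + s).+1) Theta_plus L k) + 'C(nth 0 L p - s, 2) =
  \sum_(i <- take p.+1 L) 'C(i, 2).
Proof.
have head_sum i I r : r <= i ->
    (\sum_(1 <= k < r.+1) Theta_plus (i :: I) k) + 'C(i - r, 2) = 'C(i, 2).
  elim: r => [|r IH] ri; first by rewrite big_geq // subn0.
  rewrite big_nat_recr //= Theta_plus_head ?ri // -(IH (ltnW ri)) -addnA.
  by congr addn; rewrite -(subnSK ri) binS bin1 addnC.
elim: L p => // i L IH [|p] pL /andP[s0 sp].
  by rewrite /= take0 big_seq1 /psum /= head_sum.
rewrite /= big_cons -(IH p) ?s0 // /psum /= -/(psum L p).
rewrite (@big_cat_nat _ _ _ i.+1) //=; last lia.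
have := head_sum i L i (leqnn i); rewrite subnn addn0 => ->.
rewrite -addnA; congr (_ + (_ + _)).
have -> : i.+1 = 1 + i by [].
have -> : (i + psum L p + s).+1 = (psum L p + s).+1 + i by lia.
rewrite big_addn addnK; apply: eq_big_nat => k /andP[k0 kp].
rewrite addnC Theta_plus_behead // k0 /=.
have := psum_le_sumn L p.+1; rewrite /psum (take_nth 0) ?sumn_rcons //.
move: kp; rewrite ltnS /psum; move: sp => /=; lia.
Qed.

(** Each full part [i] contributes the values [0, ..., i - 1], and the first [s] positions of the
    next part contribute ['C(s, 2)]. *)
Lemma sum_Theta_minus L p s : s <= nth 0 L p ->
  \sum_(0 <= k < psum L p + s) Theta_minus L k =
  \sum_(i <- take p L) 'C(i, 2) + 'C(s, 2).
Proof.
have head_sum i I r : r <= i ->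
    \sum_(0 <= k < r) Theta_minus (i :: I) k = 'C(r, 2).
  elim: r => [|r IH] ri; first by rewrite big_geq.
  by rewrite big_nat_recr //= Theta_minus_head // IH ?(ltnW ri) // binS bin1 addnC.
elim: L p => [|i L IH] p sp.
  by move: sp; rewrite /psum nth_nil leqn0 => /eqP->; rewrite big_geq //= big_nil.
case: p sp => [|p] sp; first by rewrite take0 big_nil /psum /= head_sum.
rewrite /= big_cons -addnA -(IH p) // /psum /= -/(psum L p).
rewrite (@big_cat_nat _ _ _ i) //=; last lia.
rewrite head_sum //; congr addn.
rewrite -addnA -{1}[i]addn0 [i + _]addnC [i + (_ + _)]addnC big_addn addnK.
by apply: eq_big_nat => k _; rewrite addnC Theta_minus_behead.
Qed.

Lemma e2_rcons (s : seq nat) i : e2 (rcons s i) = e2 s + sumn s * i.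
Proof.
rewrite /e2 size_rcons big_ord_recr /= nth_rcons ltnn eqxx; congr addn.
  apply: eq_bigr => j _; rewrite nth_rcons ltn_ord; apply: eq_bigr => k _.
  by rewrite nth_rcons (ltn_trans (ltn_ord k)).
rewrite -big_distrl /= sumnE (big_nth 0) big_mkord; congr muln.
by apply: eq_bigr => j _; rewrite nth_rcons ltn_ord.
Qed.

Lemma sum_bin2_e2 (s : seq nat) :
  'C(sumn s, 2) = \sum_(i <- s) 'C(i, 2) + e2 s.
Proof.
elim/last_ind: s => [|s i IH]; first by rewrite /e2 big_ord0 big_nil.
rewrite -cats1 big_cat big_seq1 cats1 e2_rcons sumn_rcons /= bin2D IH; lia.
Qed.

Lemma psumS L k : k < size L -> psum L k.+1 = psum L k + nth 0 L k.
Proof. by move=> kL; rewrite /psum (take_nth 0 kL) sumn_rcons. Qed.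

(* The reversal of all parts but the first turns the last [m] values of
   [Theta_plus] into the first [m] values of [Theta_minus (rot 1 I)]; both
   partial sums are sums of binomials [C(i, 2)], whose difference is [e2] of
   the parts into which [i_1] is cut. *)
Lemma DeltaE I m : 0 < m < sumn I ->
  Delta I m + \sum_(0 <= k < m) Theta_minus (rot 1 I) k =
  \sum_(1 <= k < m.+1) Theta_plus I k.
Proof.
move=> /andP[m0 mI].
have mI' : 0 < m <= sumn I by rewrite m0 ltnW.
have mL' : 0 < m <= sumn (rot 1 I).
  by rewrite (perm_sumn (permEl (perm_rot 1 I))).
have [pI sp mp] := part_locP mI'; have [qL tq mq] := part_locP mL'.
rewrite /Delta; move: (part_index I m) (part_offset I m) pI sp mp => p s.
move: (part_index (rot 1 I) m) (part_offset (rot 1 I) m) qL tq mq => q t.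
case: q => // q; case: p => // p /=; rewrite size_rot -!/(psum _ _) => qL tq mq pI sp mp.
case: I m0 mI mI' mL' qL tq mq pI sp mp => // i I.
rewrite rot1_cons [head _ _]/= => m0 mI mI' mL' qI tq mq pI sp mp.
have qI' : q <= size I by [].
have pS := psumS pI.
(* Partial sums of [rot 1 I] are those of [i :: I] shifted by [i], so [q] and [t] locate [i + m] in
   [i :: I] followed by [i]. *)
have qE : i + psum (rcons I i) q = psum (i :: I) q.+1.
  by rewrite {2}/psum /= /psum -cats1 takel_cat.
have tqI : q < size I -> t <= nth 0 (i :: I) q.+1.
  by move=> ltq; case/andP: tq => _; rewrite nth_rcons ltq.
have qS : q < size I -> psum (i :: I) q.+2 = psum (i :: I) q.+1 + nth 0 (i :: I) q.+1.
  by move=> ltq; rewrite psumS.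
have HS : \sum_(1 <= k < m.+1) Theta_plus (i :: I) k + 'C(nth 0 (i :: I) p - s, 2) =
    \sum_(j <- take p.+1 (i :: I)) 'C(j, 2).
  by rewrite mp sum_Theta_plus.
have HT : \sum_(0 <= k < m) Theta_minus (rcons I i) k + 'C(i, 2) =
    \sum_(j <- take q.+1 (i :: I)) 'C(j, 2) + 'C(t, 2).
  rewrite mq sum_Theta_minus ?(andP tq).2 //= big_cons -cats1 takel_cat //.
  by rewrite [RHS]addnAC [RHS]addnC; lia.
have pIS : p <= size I by [].
case: ifP => hi.
  (* Here [m] and [i + m] fall in the same part, which forces [t = i + s]. *)
  have qp : q.+1 = p.
    apply/eqP; rewrite eqn_leq; apply/andP; split.
      rewrite leqNgt; apply/negP => lt.
      have := psum_leq (i :: I) lt; lia.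
    rewrite leqNgt; apply/negP => lt.
    have := psum_leq (i :: I) lt; lia.
  move: pI pIS pS mp sp HS hi; rewrite -qp => pI pIS pS mp sp HS hi.
  have tE : t = i + s by lia.
  move: HS HT; rewrite (take_nth 0 pI) -cats1 big_cat big_seq1 /= tE.
  move: hi sp => /=; set u := nth 0 I q => hi sp.
  have [v ->] : exists v, u = v + s + i by exists (u - s - i); lia.
  have -> : v + s + i - s = v + i by lia.
  have -> : v + i - i = v by lia.
  rewrite !bin2D !mulnDl; lia.
(* Otherwise [i + m] falls beyond the part containing [m], and the stretch of length [i] after [m]
   is cut into the rest of that part, the whole parts [M], and [t]. *)
have pq : p <= q.
  rewrite leqNgt; apply/negP => lt.
  have ltq : q < size I by apply: leq_trans pIS.
  have := psum_leq (i :: I) (lt : q.+2 <= p.+1).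
  have := tqI ltq; have := qS ltq; lia.
set M := take _ _.
have tM : take q.+1 (i :: I) = take p.+1 (i :: I) ++ M.
  by rewrite /M -takeD; congr (take _ _); lia.
have iE : i = sumn ((nth 0 (i :: I) p - s) :: rcons M t).
  have : psum (i :: I) q.+1 = psum (i :: I) p.+1 + sumn M by rewrite /psum tM sumn_cat.
  rewrite /= sumn_rcons; lia.
have := sum_bin2_e2 ((nth 0 (i :: I) p - s) :: rcons M t).
move: HT; rewrite -iE tM big_cat big_cons -[rcons M t]cats1 big_cat big_seq1 -HS /=; lia.
Qed.

End ThetaStatistics.

(** * Weighted sums over compositions *)

Section CompositionSums.
Implicit Types (I J K : seq nat) (l m n : nat).

Definition comps n := fset_set (compositions n).

Lemma mem_comps n I : (I \in comps n) = all (leq 1) I && (sumn I == n).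
Proof.
rewrite in_fset_set; last exact: compositions_finite.
by apply/idP/andP => [|[h /eqP s]]; rewrite inE => // -[h ->].
Qed.

Lemma comps_sumn n I : I \in comps n -> sumn I = n.
Proof. by rewrite mem_comps => /andP[_ /eqP]. Qed.

Lemma comps_nonnil n I : 0 < n -> I \in comps n -> I != [::].
Proof. by move=> n0; case: I => // /comps_sumn /= n0'; rewrite -n0' in n0. Qed.

(** The first part of [I] counts as itself in [weight I] but less one in [weight (J ++ I)];
    cross-multiplying avoids a division. *)
Lemma weight_cat J I : J != [::] -> I != [::] ->
  (head 0 I - 1) * (weight I * weight J) = head 0 I * weight (J ++ I).
Proof.
case: J I => [|j J] [|i I] // _ _; rewrite /weight /= big_cat big_cons /=.
by lia.
Qed.

Lemma weight_rcons J i : J != [::] -> weight (rcons J i) = (i - 1) * weight J.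
Proof.
case: J => // j J _; rewrite /weight /= -cats1 big_cat big_seq1 /=.
by rewrite mulnA mulnC.
Qed.

Lemma weight1 i : weight [:: i] = i.
Proof. by rewrite /weight /= big_nil muln1. Qed.

Lemma weight_perm I J : perm_eq I J -> head 0 I = head 0 J -> weight I = weight J.
Proof.
move=> IJ; have := perm_size IJ; case: I J IJ => [|i I] [|j J] //= + _ ij.
by rewrite ij perm_cons /weight /= => p; rewrite (perm_big _ p).
Qed.

Lemma perm_map_comps n (s : seq nat -> seq nat) :
  {in comps n, forall I, perm_eq (s I) I} -> {in comps n, involutive s} ->
  perm_eq (map s (comps n)) (comps n).
Proof.
move=> sp ss; have sn I : I \in comps n -> s I \in comps n.
  move=> In; move: (In); rewrite !mem_comps (perm_sumn (sp I In)).
  by rewrite (perm_all _ (sp I In)).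
apply: uniq_perm; [|exact: fset_uniq|].
  rewrite map_inj_in_uniq ?fset_uniq // => I J IP JP e.
  by rewrite -(ss I IP) e ss.
move=> I; apply/mapP/idP => [[J JP ->]|IP]; first exact: sn.
by exists (s I); [exact: sn|rewrite ss].
Qed.

(** A composition with [l] as a partial sum is cut there into two. The cut is unique because
    positive parts make partial sums strictly increasing. *)
Lemma perm_comps_cat l m :
  perm_eq [seq J ++ K | J <- comps l, K <- comps m]
          [seq K <- comps (l + m) | Theta_plus K l == 0].
Proof.
apply: uniq_perm.
- apply: allpairs_uniq; [exact: fset_uniq | exact: fset_uniq |].
  move=> [J I] [J' I'].
  move=> /allpairsP[[J1 I1] /= [J1P I1P [-> ->]]].
  move=> /allpairsP[[J2 I2] /= [J2P I2P [-> ->]]] {J I J' I'} e.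
  suff sz : size J1 = size J2.
    by move/eqP: e; rewrite eqseq_cat // => /andP[/eqP-> /eqP->].
  have pos K : all (leq 1) K -> forall i j, i < j -> j <= size K -> psum K i < psum K j.
    move=> Kpos i j ij jK; apply: leq_trans (psum_leq K ij).
    rewrite psumS ?(leq_trans ij) // -addn1 leq_add2l.
    by apply: (allP Kpos); rewrite mem_nth // (leq_trans ij).
  have Kpos : all (leq 1) (J1 ++ I1).
    by move: J1P I1P; rewrite !mem_comps all_cat => /andP[-> _] /andP[-> _].
  have p1 : psum (J1 ++ I1) (size J1) = l by rewrite /psum take_size_cat // (comps_sumn J1P).
  have p2 : psum (J1 ++ I1) (size J2) = l by rewrite e /psum take_size_cat // (comps_sumn J2P).
  apply/eqP; rewrite eqn_leq; apply/andP; split; rewrite leqNgt; apply/negP => lt.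
    by have := pos _ Kpos _ _ lt; rewrite p1 p2 ltnn size_cat leq_addr => /(_ isT).
  by have := pos _ Kpos _ _ lt; rewrite p1 p2 ltnn e size_cat leq_addr => /(_ isT).
- exact/filter_uniq/fset_uniq.
move=> K; rewrite mem_filter; apply/allpairsP/andP => [[[J I] /= [JP IP ->]]|[K0 KP]].
  have KP : J ++ I \in comps (l + m).
    move: JP IP; rewrite !mem_comps all_cat sumn_cat.
    by move=> /andP[-> /eqP->] /andP[-> /eqP->] /=.
  split=> //; apply/Theta_plus_eq0; first by rewrite (comps_sumn KP) leq_addr.
  by exists (size J); rewrite /psum take_size_cat // (comps_sumn JP).
have [|k kl] := Theta_plus_eq0 (I := K) (x := l) _ K0.
  by rewrite (comps_sumn KP) leq_addr.
exists (take k K, drop k K); rewrite /= cat_take_drop; split=> //.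
  move: KP; rewrite !mem_comps -{1}(cat_take_drop k K) all_cat.
  by rewrite -/(psum K k) kl eqxx => /andP[/andP[-> _] _].
move: KP; rewrite !mem_comps -{1 2}(cat_take_drop k K) all_cat sumn_cat.
by rewrite -/(psum K k) kl eqn_add2l => /andP[/andP[_ ->] ->].
Qed.

(** Made for a recursion on the last part. The one-part composition stands apart because its last
    part is also its first and is weighted differently. *)
Lemma perm_comps_rcons n : 0 < n ->
  perm_eq (comps n)
    ([:: n] :: [seq rcons J i | i <- index_iota 1 n, J <- comps (n - i)]).
Proof.
move=> n0; apply: uniq_perm; first exact: fset_uniq.
  rewrite cons_uniq; apply/andP; split.
    apply/negP => /allpairsPdep[i [J [+ JP]]].
    rewrite mem_index_iota => /andP[i0 ilt] /(congr1 size).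
    rewrite size_rcons /= => -[]; have : J != [::] by apply: comps_nonnil JP; lia.
    by case: J JP.
  apply: allpairs_uniq_dep => [|i _|]; [exact: iota_uniq|exact: fset_uniq|].
  move=> [i J] [i' J'] _ _ /= /eqP; rewrite eqseq_rcons => /andP[/eqP-> /eqP->] //.
move=> K; rewrite inE; apply/idP/orP => [KP|[/eqP->|]].
- have := comps_nonnil n0 KP; case/lastP: K KP => // J i KP _.
  move: (KP); rewrite mem_comps all_rcons sumn_rcons => /andP[/andP[i0 Jpos] /eqP s].
  have [J0|J0] := eqVneq J [::]; [left|right].
    by rewrite J0 /= in s *; rewrite -s.
  have sJ : 0 < sumn J.
    by case: J J0 Jpos {s KP} => //= j J _ /andP[j0 _]; rewrite ltn_addr.
  apply/allpairsPdep; exists i, J; rewrite mem_index_iota mem_comps Jpos /=; split=> //; lia.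
- by rewrite mem_comps /= n0 addn0 eqxx.
move=> /allpairsPdep[i [J [+ JP ->]]]; rewrite mem_index_iota => /andP[i0 ilt].
move: JP; rewrite !mem_comps all_rcons sumn_rcons i0 => /andP[-> /eqP->] /=.
by rewrite subnK // ltnW.
Qed.

(** * The involution [phi] *)

Lemma phi_cutP a I : a <= sumn I ->
  [/\ phi_cut a I <= size I, a <= sumn (drop (phi_cut a I) I) &
      forall j, j <= size I -> a <= sumn (drop j I) -> j <= phi_cut a I].
Proof.
move=> aI; have ex : exists j, (j <= size I) && (a <= sumn (drop j I)).
  by exists 0; rewrite drop0.
have bd j : (j <= size I) && (a <= sumn (drop j I)) -> j <= size I by case/andP.
case: (ex_maxnP ex bd) => c /andP[cI ca] cmax.
suff -> : phi_cut a I = c by split=> // j jI ja; rewrite cmax ?jI.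
apply/eqP; rewrite eqn_leq; apply/andP; split.
  by apply/bigmax_leqP => -[j /= jlt] ja; rewrite cmax // ja andbT.
by rewrite (bigmax_sup (Ordinal (cI : c < (size I).+1))).
Qed.

Lemma phi_perm a I : perm_eq (phi a I) I.
Proof.
rewrite /phi -[X in perm_eq _ X](cat_take_drop (phi_cut a I) I).
case E: (take _ I) => [|i P]; first by rewrite -E cat_take_drop.
by rewrite /= perm_cons perm_cat2r perm_rev.
Qed.

Lemma phi_head a I : head 0 (phi a I) = head 0 I.
Proof. by rewrite /phi; case: I => [|i I]; case: (phi_cut _ _). Qed.

(* [phi] does not move the cut: the parts after it stay in place. *)
Lemma phi_cut_phi a I : a <= sumn I -> phi_cut a (phi a I) = phi_cut a I.
Proof.
move=> aI; have [cI ca cmax] := phi_cutP aI.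
have sz : size (phi a I) = size I by apply/perm_size/phi_perm.
have aI' : a <= sumn (phi a I) by rewrite (perm_sumn (phi_perm a I)).
have [cI' ca' cmax'] := phi_cutP aI'.
have dE j : phi_cut a I <= j -> drop j (phi a I) = drop j I.
  rewrite /phi; case E: (take _ I) => [|i P] // cj.
  have szP : size (i :: rev P) = phi_cut a I.
    by rewrite /= size_rev -[(size P).+1]/(size (i :: P)) -E size_take_min (minn_idPl cI).
  by rewrite -cat_cons drop_cat szP ltnNge cj /= drop_drop subnK.
have le : phi_cut a I <= phi_cut a (phi a I) by rewrite cmax' ?sz ?dE.
apply/eqP; rewrite eqn_leq le andbT cmax -?sz //.
by rewrite -dE.
Qed.

Lemma phiK a I : a <= sumn I -> phi a (phi a I) = I.
Proof.
move=> aI; have [cI _ _] := phi_cutP aI; rewrite {1}/phi phi_cut_phi //.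
rewrite /phi; case E: (take _ I) => [|i P]; first by rewrite E.
have szP : size (i :: rev P) = phi_cut a I.
  by rewrite /= size_rev -[(size P).+1]/(size (i :: P)) -E size_take_min (minn_idPl cI).
rewrite -cat_cons take_size_cat // drop_size_cat //= revK.
by rewrite -cat_cons -E cat_take_drop.
Qed.

(** * Weighted sums with values in a ring *)

Variables (R : comNzRingType) (e : nat -> R).
Local Open Scope ring_scope.

Definition eprod I : R := \prod_(i <- I) e i.

Definition wsum n (f : seq nat -> int) : R :=
  \sum_(I <- comps n) eprod I *~ (f I * (weight I)%:Z).

Lemma eq_wsum n (f g : seq nat -> int) : {in comps n, f =1 g} -> wsum n f = wsum n g.
Proof. by move=> fg; apply: eq_big_seq => I /fg ->. Qed.

Lemma wsumD n (f g : seq nat -> int) :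
  wsum n (fun I => f I + g I) = wsum n f + wsum n g.
Proof. by rewrite -big_split; apply: eq_bigr => I _; rewrite mulrDl mulrzDr. Qed.

Lemma wsumB n (f g : seq nat -> int) :
  wsum n (fun I => f I - g I) = wsum n f - wsum n g.
Proof. by rewrite -sumrB; apply: eq_bigr => I _; rewrite mulrBl mulrzBr. Qed.

Lemma wsum0 n : wsum n (fun=> 0) = 0.
Proof. by rewrite /wsum big1 // => I _; rewrite mul0r mulr0z. Qed.

Lemma wsum_sum n (T : Type) (r : seq T) (f : T -> seq nat -> int) :
  wsum n (fun I => \sum_(k <- r) f k I) = \sum_(k <- r) wsum n (f k).
Proof.
elim: r => [|k r IH].
  by rewrite big_nil -(wsum0 n); apply: eq_wsum => I _; rewrite big_nil.
by rewrite big_cons -IH -wsumD; apply: eq_wsum => I _; rewrite big_cons.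
Qed.

(** [eprod] and [weight] are invariant under rearrangements that keep the first part, so [s] merely
    reindexes the sum. *)
Lemma wsum_involutive n (s : seq nat -> seq nat) (f : seq nat -> int) :
    {in comps n, forall I, perm_eq (s I) I} -> {in comps n, involutive s} ->
    {in comps n, forall I, head 0%N (s I) = head 0%N I} ->
  wsum n (fun I => f (s I)) = wsum n f.
Proof.
move=> sp ss sh; rewrite [RHS]/wsum -(perm_big _ (perm_map_comps sp ss)) big_map.
apply: eq_big_seq => I IP; rewrite (weight_perm (sp I IP)) ?sh //.
by rewrite /eprod (perm_big _ (sp I IP)).
Qed.

(** Since [Theta_plus I 1] is [head 0 I - 1], [weight_cat] turns the product of weights into
    [head 0 I * weight (J ++ I)]; and this head is [Theta_plus (J ++ I) l.+1 + 1]. *)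
Lemma wsumM l m : (0 < l)%N -> (0 < m)%N ->
  wsum m (fun I => (Theta_plus I 1)%:Z) * wsum l (fun=> 1) =
  wsum (l + m) (fun K => if Theta_plus K l == 0%N then (Theta_plus K l.+1)%:Z + 1 else 0).
Proof.
move=> l0 m0; have -> : wsum (l + m) (fun K => if Theta_plus K l == 0%N then
      (Theta_plus K l.+1)%:Z + 1 else 0) =
    \sum_(K <- comps (l + m) | Theta_plus K l == 0%N)
      eprod K *~ (((Theta_plus K l.+1)%:Z + 1) * (weight K)%:Z).
  rewrite big_mkcond; apply: eq_bigr => K _.
  by case: ifP => // _; rewrite mul0r mulr0z.
rewrite mulrC big_distrlr /=.
rewrite -[RHS]big_filter -(perm_big _ (perm_comps_cat l m)) big_allpairs_dep.
apply: eq_big_seq => J JP; apply: eq_big_seq => K KP.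
have J0 := comps_nonnil l0 JP; have K0 := comps_nonnil m0 KP.
have [k0 kP] : (0 < head 0 K /\ Theta_plus K 1 = head 0 K - 1)%N.
  move: KP; rewrite mem_comps; case: K K0 => // k K _ /andP[/andP[k0 _] _].
  by rewrite Theta_plus_head.
have -> : Theta_plus (J ++ K) l.+1 = (head 0 K - 1)%N.
  rewrite -kP -addn1; have := comps_sumn JP; have := comps_sumn KP.
  elim: J l {l0 JP J0} => [|j J IH] l sK sJ; first by rewrite -sJ add0n.
  rewrite -sJ /= -addnA Theta_plus_behead.
    exact: IH.
  by rewrite addn1 /= sumn_cat; lia.
have -> : ((head 0 K - 1)%N%:Z + 1)%R = (head 0%N K)%:Z by lia.
rewrite mulrzAl mulrzAr mul1r kP /eprod big_cat /=.
by rewrite -mulrzA -!PoszM -weight_cat // mulnA.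
Qed.

(** Where [l] is not a partial sum, [Theta_plus] drops by one from [l] to [l.+1]. Where it is,
    [Theta_plus K l] vanishes and the product from [wsumM] supplies the next value. *)
Lemma wsum_Theta_plusS l m : (0 < l)%N -> (0 < m)%N ->
  wsum (l + m) (fun K => (Theta_plus K l.+1)%:Z) =
  wsum m (fun K => (Theta_plus K 1)%:Z) * wsum l (fun=> 1)
  + wsum (l + m) (fun K => (Theta_plus K l)%:Z) - wsum (l + m) (fun=> 1).
Proof.
move=> l0 m0; rewrite wsumM // -wsumD -wsumB; apply: eq_wsum => K KP.
have [/eqP z|z] := boolP (Theta_plus K l == 0%N); first by rewrite z; lia.
have := @Theta_plusS K l; rewrite (comps_sumn KP) lt0n z; lia.
Qed.

Lemma wsum1_rec n : (0 < n)%N ->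
  wsum n (fun=> 1) = e n *+ n + \sum_(1 <= i < n) e i *+ (i - 1) * wsum (n - i) (fun=> 1).
Proof.
move=> n0; rewrite {1}/wsum (perm_big _ (perm_comps_rcons n0)) big_cons /=.
rewrite weight1 mul1r /eprod big_seq1 pmulrn; congr (_ + _).
rewrite big_allpairs_dep; apply: eq_big_nat => i /andP[i0 ilt].
rewrite big_distrr; apply: eq_big_seq => J JP.
rewrite weight_rcons ?(comps_nonnil _ JP) ?subn_gt0 // !mul1r -!pmulrn.
by rewrite -cats1 big_cat big_seq1 /= mulrnAl mulrnAr -mulrnA mulrC mulnC.
Qed.

Lemma wsum_phi a n (f : seq nat -> int) : (a <= n)%N ->
  wsum n (fun I => f (phi a I)) = wsum n f.
Proof.
move=> an; apply: wsum_involutive => I IP.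
- exact: phi_perm.
- by apply: phiK; rewrite (comps_sumn IP).
- exact: phi_head.
Qed.

Lemma wsum_rev_behead n (f : seq nat -> int) :
  wsum n (fun I => f (take 1 I ++ rev (behead I))) = wsum n f.
Proof.
apply: (@wsum_involutive _ (fun I => take 1 I ++ rev (behead I))) => I _.
- by case: I => //= i I; rewrite take0 perm_cons perm_rev.
- by case: I => //= i I; rewrite !take0 /= revK.
- by case: I => //= i I; rewrite take0.
Qed.

(** Each [Theta_minus] of a reversed composition becomes a [Theta_plus] at the complementary index,
    and [DeltaE] expands [Delta]. The rearrangements [phi a] and [r] then disappear under the
    weighted sum. *)
Lemma wsum_theta_coef a b c : (0 < a)%N -> (0 < b)%N -> (0 < c)%N ->
    let n := (a + b + c - 1)%N in let m := (b + c - 1)%N in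
    let T k := wsum n (fun I => (Theta_plus I k)%:Z) in
  wsum n (theta_coef a b c) =
  \sum_(2 <= k < c.+1) T k - \sum_(b.+1 <= k < b + c) T k
  + (\sum_(1 <= k < m.+1) T k - \sum_(a.+1 <= k < n.+1) T k).
Proof.
move=> a0 b0 c0 n m T.
pose r := fun I => take 1 I ++ rev (behead I).
have split4 (f g h k : seq nat -> int) : wsum n (fun I => f I - g I + (h I - k I)) =
    wsum n f - wsum n g + (wsum n h - wsum n k) by rewrite wsumD !wsumB.
rewrite /T -!wsum_sum.
rewrite (@eq_wsum _ _ (fun I => (\sum_(2 <= k < c.+1) (Theta_plus I k)%:Z
   - \sum_(b.+1 <= k < b + c) (Theta_plus (phi a I) k)%:Z)
   + (\sum_(1 <= k < m.+1) (Theta_plus I k)%:Z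
   - \sum_(a.+1 <= k < n.+1) (Theta_plus (r I) k)%:Z))).
  rewrite split4.
  congr (_ - _ + (_ - _)).
    by apply: (wsum_phi (fun I => \sum_(b.+1 <= k < b + c) (Theta_plus I k)%:Z)); lia.
  exact: (wsum_rev_behead n (fun I => \sum_(a.+1 <= k < n.+1) (Theta_plus I k)%:Z)).
move=> I IP; have In := comps_sumn IP; rewrite /theta_coef; congr (_ - _ + _).
  rewrite [RHS]big_nat_rev /= -{1}[a]add0n -{1}[b.+1]add0n !big_addn.
  have -> : (a + c - 1 - a = b + c - b.+1)%N by lia.
  apply: eq_big_nat => k /andP[_ kc]; congr Posz.
  rewrite Theta_minus_rev (perm_sumn (phi_perm a I)) In; last lia.
  by congr Theta_plus; lia.
have mn : (0 < m < sumn I)%N by rewrite In; lia.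
have := congr1 Posz (DeltaE mn); rewrite PoszD /= -/m.
rewrite !(big_morph Posz PoszD (erefl _)) => <-.
suff -> : (\sum_(0 <= k < m) (Theta_minus (rot 1 I) k)%:Z =
   \sum_(a.+1 <= k < n.+1) (Theta_plus (r I) k)%:Z)%R by rewrite addrK.
rewrite [RHS]big_nat_rev /= -{1}[a.+1]add0n big_addn.
have -> : (n.+1 - a.+1 = m)%N by lia.
apply: eq_big_nat => k /andP[_ km]; congr Posz.
(* This is what makes [Theta_minus_rev] applicable to [rot 1 I]. *)
have rI : rot 1 I = rev (r I).
  by rewrite /r; case: (I) => //= i L; rewrite rot1_cons take0 /= rev_cons revK.
have sr : sumn (r I) = n by rewrite -In -(sumn_rev (r I)) -rI (perm_sumn (permEl (perm_rot 1 I))).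
rewrite rI Theta_minus_rev sr; last lia.
by congr Theta_plus; lia.
Qed.

End CompositionSums.

(** * Colourings by transfer matrices *)

Section Transfer.
Local Open Scope ring_scope.
Variables (C : finType) (R : comNzRingType) (x : C -> R).
Implicit Types (u v w : C) (k l m n : nat).

(* [walk l u v] sums over the colours of the [l] inner vertices of a path whose
   ends are coloured [u] and [v].  Accordingly [path_sum l] has [l.+1] vertices,
   [tadpole_sum k l] a cycle of length [k.+1] with a tail of length [l], and
   [theta_sum a b c] counts inner vertices, i.e. lengths minus one. *)
Fixpoint walk l u v : R :=
  if l is l'.+1 then \sum_(w | w != u) x w * walk l' w v else (u != v)%:R.

Fixpoint tail l v : R :=
  if l is l'.+1 then \sum_(w | w != v) x w * tail l' w else 1.

Definition path_sum l := \sum_v x v * tail l v.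

Definition tadpole_sum k l := \sum_v x v * walk k v v * tail l v.

Definition theta_sum a b c :=
  \sum_u \sum_v x u * x v * (walk a u v * walk b u v * walk c u v).

Lemma sum_neq u (F : C -> R) : \sum_(w | w != u) F w = \sum_w F w - F u.
Proof. by rewrite [\sum_w F w](bigD1 u) //= addrC addrK. Qed.

Lemma walkSr l u v : walk l.+1 u v = \sum_(w | w != v) walk l u w * x w.
Proof.
elim: l u => [|l IH] u.
  rewrite /= big_mkcond [RHS]big_mkcond /=; apply: eq_bigr => w _.
  by rewrite (eq_sym u w); case: (w != u); case: (w != v); rewrite /= ?mulr1 ?mul1r ?mulr0 ?mul0r.
rewrite [LHS]/=; under eq_bigr => w _ do rewrite -/(walk l.+1 w v) IH big_distrr.
rewrite exchange_big; apply: eq_bigr => w _ /=.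
by rewrite big_distrl; apply: eq_bigr => w' _ /=; rewrite mulrA.
Qed.

Lemma walk_sym l u v : walk l u v = walk l v u.
Proof.
elim: l u v => [|l IH] u v; first by rewrite /= eq_sym.
by rewrite walkSr; apply: eq_bigr => w _; rewrite mulrC IH.
Qed.

Lemma walk_comp k l v w :
  \sum_u walk k v u * x u * walk l u w = walk (k + l).+1 v w.
Proof.
elim: k v => [|k IH] v.
  rewrite [RHS]/= [RHS]big_mkcond /=; apply: eq_bigr => u _.
  by rewrite eq_sym; case: (u != v); rewrite ?mul1r ?mul0r.
rewrite addSn [RHS]/=; under [RHS]eq_bigr => u _ do rewrite -/(walk (k + l).+1 u w) -IH big_distrr.
rewrite exchange_big; apply: eq_bigr => u _ /=.
by rewrite big_distrl big_distrl; apply: eq_bigr => w' _ /=; rewrite !mulrA.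
Qed.

Lemma sum_walk l v : \sum_u x u * walk l u v = tail l.+1 v.
Proof.
elim: l v => [|l IH] v.
  rewrite /= [RHS]big_mkcond /=; apply: eq_bigr => u _.
  by case: (u != v); rewrite ?mulr1 ?mulr0.
under eq_bigr => u _ do rewrite walkSr big_distrr.
rewrite exchange_big [RHS]/=; apply: eq_bigr => w _; rewrite -/(tail l.+1 w) -IH.
by rewrite big_distrr; apply: eq_bigr => u _ /=; rewrite mulrA mulrC.
Qed.

Lemma walkS_tail l u v : walk l.+1 u v = tail l.+1 v - x u * walk l u v.
Proof. by rewrite [LHS]/= sum_neq sum_walk. Qed.

Lemma tailS l v : tail l.+1 v = path_sum l - x v * tail l v.
Proof. by rewrite /= sum_neq. Qed.

(** Two paths glued at an end vertex form one path; the induction slides the gluing vertex along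
    it. *)
Lemma sum_tail_tail l m : \sum_v x v * (tail l v * tail m v) = path_sum (l + m).
Proof.
elim: m l => [|m IH] l.
  by rewrite addn0; apply: eq_bigr => v _; rewrite mulr1.
rewrite addnS -addSn -IH /=.
transitivity (\sum_v \sum_w (if w != v then x v * x w * (tail l v * tail m w) else 0)).
  apply: eq_bigr => v _; rewrite -big_mkcond !big_distrr /=.
  by apply: eq_bigr => w _; ring.
rewrite exchange_big; apply: eq_bigr => w _; rewrite big_distrl big_distrr /=.
rewrite [RHS]big_mkcond; apply: eq_bigr => v _ /=.
by rewrite eq_sym; case: ifP => // _; ring.
Qed.

Lemma tadpole_sum_loop l : tadpole_sum 0 l = 0.
Proof. by rewrite /tadpole_sum big1 // => v _; rewrite /= eqxx mulr0 mul0r. Qed.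

(* Triple deletion: in the sum over the colour [w] of a vertex next to [u], the
   condition [w != u] is dropped and the contribution of [w = u] subtracted. *)
Lemma tadpole_sumS k l :
  tadpole_sum k l.+1 =
  tadpole_sum k 0 * path_sum l + tadpole_sum k.+1 l - path_sum (k + l).+1.
Proof.
rewrite -addSn -sum_tail_tail /tadpole_sum big_distrl -big_split -sumrB.
by apply: eq_bigr => v _; rewrite tailS walkS_tail /=; ring.
Qed.

Lemma theta_sum_walk a b l :
  \sum_u \sum_v x u * x v * (walk a u v * walk b u v * tail l v) =
  tadpole_sum (a + b).+1 l.
Proof.
rewrite exchange_big; apply: eq_bigr => v _; rewrite -walk_comp.
rewrite !big_distrr big_distrl /=; apply: eq_bigr => u _.
by rewrite (walk_sym a u v); ring.
Qed.

(** Expand [walk c.+1] on the left and [walk b.+1] on the right by [walkS_tail]: the terms with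
    [x u * walk b u v * walk c u v] cancel, and the tails give tadpoles. *)
Lemma theta_sumS a b c :
  theta_sum a b c.+1 = theta_sum a b.+1 c
    + tadpole_sum (a + b).+1 c.+1 - tadpole_sum (a + c).+1 b.+1.
Proof.
rewrite -!theta_sum_walk /theta_sum -big_split -sumrB; apply: eq_bigr => u _.
by rewrite -big_split -sumrB; apply: eq_bigr => v _; rewrite !walkS_tail /=; ring.
Qed.

Lemma theta_sum_rot a b c : theta_sum a b c = theta_sum c a b.
Proof.
by apply: eq_bigr => u _; apply: eq_bigr => v _; ring.
Qed.

(** Two of the three paths are the same edge, whose condition counts once; the third path closes it
    to a cycle. *)
Lemma theta_sum_cycle a : theta_sum 0 a 0 = tadpole_sum a.+1 0.
Proof.
rewrite /theta_sum exchange_big; apply: eq_bigr => v _; rewrite mulr1.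
have -> : walk a.+1 v v = \sum_u (if u != v then x u * walk a u v else 0).
  by rewrite -big_mkcond.
rewrite big_distrr /=.
by apply: eq_bigr => u _; case: (u != v); rewrite /= ?mulr0 ?mul0r //; ring.
Qed.

(** Iterates [theta_sumS] until the third path is an edge. All graphs involved have [N.+1]
    vertices. *)
Lemma theta_sum_reduce N a b c : (a + b + c).+1 = N ->
  theta_sum a b c = theta_sum a (b + c) 0
    + \sum_(1 <= l < c.+1) tadpole_sum (N - l) l
    - \sum_(b.+1 <= l < (b + c).+1) tadpole_sum (N - l) l.
Proof.
elim: c b => [|c IH] b abc; first by rewrite addn0 !big_geq // addr0 subr0.
rewrite theta_sumS (IH b.+1) -?abc ?addnS ?addSn //.
rewrite [\sum_(1 <= l < c.+2) _]big_nat_recr //=.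
rewrite [\sum_(b.+1 <= l < _) _]big_ltn ?ltnS ?leqW ?leq_addr //.
have -> : ((a + b + c).+2 - c.+1 = (a + b).+1)%N by lia.
have -> : ((a + b + c).+2 - b.+1 = (a + c).+1)%N by lia.
by ring.
Qed.

(** * Path sums in terms of elementary symmetric polynomials *)

Definition elem_sum k := \sum_(S : {set C} | #|S| == k) \prod_(i in S) x i.

Local Notation f := (fun i => (x i *: 'X + 1) : {poly R}).

Lemma coef_prod_elem k : (\prod_i f i)`_k = elem_sum k.
Proof.
rewrite bigA_distr coef_sum /elem_sum [RHS]big_mkcond /=; apply: eq_bigr => S _.
rewrite -big_mkcond /= scaler_prod prodr_const coefZ coefXn eq_sym.
by case: eqP; rewrite ?mulr1 ?mulr0.
Qed.

Lemma deriv_prod (T : eqType) (r : seq T) (F : T -> {poly R}) : uniq r ->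
  (\prod_(i <- r) F i)^`() =
  \sum_(j <- r) (F j)^`() * \prod_(i <- r | i != j) F i.
Proof.
elim: r => [|a r IH] /=; first by rewrite !big_nil derivC.
case/andP=> ar ur; rewrite !big_cons derivM IH // eqxx; congr (_ * _ + _).
  rewrite big_seq [RHS]big_seq_cond; apply: eq_bigl => i.
  by case: eqVneq => [->|]; rewrite ?(negPf ar) ?andbT.
rewrite big_distrr; apply: eq_big_seq => j jr /=.
rewrite big_cons ifT; first by rewrite mulrCA.
by apply: contra ar => /eqP ->.
Qed.

(** Indexed by the number of vertices, the empty path giving the constant term. *)
Definition path_series n := if n is l.+1 then path_sum l else 1.

(* Coefficientwise form of [E * (S - 1) = X * E' * S], where [E] and [S] generate
   the elementary symmetric functions and the path sums. *)
Lemma path_series_conv n :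
  \sum_(i < n.+1) elem_sum i * path_series (n - i) - elem_sum n =
  \sum_(i < n.+1) elem_sum i *+ i * path_series (n - i).
Proof.
(* [Fp j] generates the paths whose first vertex is coloured [j]. The series are truncated to
   polynomials, and [eqm] is congruence modulo the power [n.+1] of ['X]. *)
pose F j i := if i is l.+1 then x j * tail l j else 0.
pose S : {poly R} := \poly_(i < n.+1) path_series i.
pose Fp j : {poly R} := \poly_(i < n.+1) F j i.
pose eqm (p q : {poly R}) := forall i, (i <= n)%N -> p`_i = q`_i.
have eqmM p q r : eqm p q -> eqm (r * p) (r * q).
  move=> pq i ni; rewrite !coefM; apply: eq_bigr => j _; congr (_ * _).
  by apply: pq; rewrite (leq_trans (leq_subr _ _)).
have FS j : eqm (f j * Fp j) (x j *: ('X * S)).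
  case=> [|i] ni; rewrite mulrDl mul1r -scalerAl coefD !coefZ !coefXM ?coef_poly /=.
    by rewrite /= mulr0 addr0.
  rewrite !ltnS ni (ltnW ni) /=.
  case: i {ni} => [|i]; first by rewrite mulr0 add0r.
  by rewrite [path_series _]/= tailS /F; ring.
have S1 : eqm (S - 1) (\sum_j Fp j).
  move=> i ni; rewrite coefB coef_poly coef1 coef_sum ltnS ni.
  under eq_bigr => j _ do rewrite coef_poly ltnS ni.
  by case: i {ni} => [|i] /=; rewrite ?subr0 // subrr big1.
pose E := \prod_i f i.
(* By [S1] and [FS], the factor [f j] of [E] turns [Fp j] into [x j *: ('X * S)], and [x j] is the
   derivative of [f j]; the product rule collects the terms. *)
have : eqm (E * (S - 1)) ('X * E^`() * S).
  move=> i ni; rewrite (eqmM _ _ E S1) // big_distrr /= deriv_prod ?index_enum_uniq //.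
  rewrite big_distrr big_distrl !coef_sum /=; apply: eq_bigr => j _.
  rewrite /E (bigD1 j) //= mulrAC mulrC (eqmM _ _ _ (FS j)) //.
  congr ((polyseq _)`_i); rewrite derivD derivZ derivX derivC addr0 alg_polyC -mul_polyC.
  by ring.
move=> /(_ n (leqnn n)); rewrite mulrBr mulr1 coefB !coefM coef_prod_elem.
under [X in X - _ = _]eq_bigr => i _ do
  rewrite coef_prod_elem coef_poly ltnS leq_subr.
move=> ->; apply: eq_bigr => -[[|i] ni] _; rewrite coefXM /= ?mulr0n ?mul0r //.
by rewrite coef_deriv coef_prod_elem coef_poly ltnS leq_subr.
Qed.

(** Solves the convolution for its term [i = 0], as [elem_sum 0] is 1; the left term [i = n] cancels
    [elem_sum n]. *)
Lemma path_series_rec n : (0 < n)%N ->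
  path_series n = elem_sum n *+ n
    + \sum_(1 <= i < n) elem_sum i *+ (i - 1) * path_series (n - i).
Proof.
move=> n0; have := path_series_conv n.
have e0 : elem_sum 0 = 1.
  by rewrite /elem_sum (big_pred1 finset.set0) ?big_set0 // => S; rewrite cards_eq0.
have split3 (g : nat -> R) : \sum_(i < n.+1) g i = g 0%N + \sum_(1 <= i < n) g i + g n.
  by rewrite -(big_mkord xpredT) big_nat_recr //= big_ltn.
rewrite (split3 (fun i => elem_sum i * path_series (n - i))).
rewrite (split3 (fun i => elem_sum i *+ i * path_series (n - i))).
rewrite subnn subn0 e0 mulr0n mul0r add0r mul1r !mulr1 addrK => /(canRL (addrK _)) ->.
rewrite addrC addrA addrC; congr (_ + _); rewrite addrC -sumrB.
apply: eq_big_nat => i /andP[i0 _]; rewrite -mulrBl; congr (_ * _).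
by rewrite mulrnBr // mulr1n.
Qed.

Lemma path_series_wsum n : (0 < n)%N -> path_series n = wsum elem_sum n (fun=> 1).
Proof.
elim/ltn_ind: n => n IH n0; rewrite path_series_rec // wsum1_rec //; congr (_ + _).
by apply: eq_big_nat => i /andP[i0 ilt]; rewrite IH //; lia.
Qed.

(* For fixed [k + l] the recursion of [tadpole_sumS] matches that of
   [wsum_Theta_plusS], and both sides vanish at [k = 0]. *)
Lemma tadpole_sum_wsum k l :
  tadpole_sum k l = wsum elem_sum (k + l).+1 (fun I => (Theta_plus I l.+1)%:Z).
Proof.
(* The inner induction on [k] trades cycle length for tail length; the outer one, on a bound for
   [k + l], handles the smaller factor [tadpole_sum k 0]. *)
move: {2}(k + l)%N (leqnn (k + l)) => N; elim: N k l => [|N IH] k l.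
  rewrite leqn0 addn_eq0 => /andP[/eqP-> /eqP->]; rewrite tadpole_sum_loop.
  rewrite -[LHS](wsum0 elem_sum 1); apply: eq_wsum => I /comps_sumn <-.
  by rewrite Theta_plus_sumn.
elim: k l => [|k IHk] l kl.
  rewrite tadpole_sum_loop add0n -[LHS](wsum0 elem_sum l.+1).
  by apply: eq_wsum => I /comps_sumn <-; rewrite Theta_plus_sumn.
have h := tadpole_sumS k l.
have -> : tadpole_sum k.+1 l =
    tadpole_sum k l.+1 + path_sum (k + l).+1 - tadpole_sum k 0 * path_sum l by rewrite h; ring.
rewrite IHk; last by rewrite addnS.
rewrite (IH k 0); last by lia.
rewrite -[path_sum l]/(path_series l.+1) -[path_sum _]/(path_series (k + l).+2).
rewrite !path_series_wsum //.
have := @wsum_Theta_plusS _ elem_sum l.+1 k.+1 isT isT.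
have -> : (k.+1 + l = k + l.+1)%N by lia.
have -> : (l.+1 + k.+1 = (k + l.+1).+1)%N by lia.
have -> : ((k + l).+2 = (k + l.+1).+1)%N by lia.
by rewrite addn0 => ->; ring.
Qed.

Lemma theta_sum_wsum a b c :
  theta_sum a b c =
  wsum elem_sum (a.+1 + b.+1 + c.+1 - 1) (theta_coef a.+1 b.+1 c.+1).
Proof.
rewrite wsum_theta_coef //.
have -> : (a.+1 + b.+1 + c.+1 - 1 = (a + b + c).+2)%N by lia.
have -> : (b.+1 + c.+1 - 1 = (b + c).+1)%N by lia.
set N := (a + b + c).+1.
have TE l : (l <= N)%N ->
    tadpole_sum (N - l) l = wsum elem_sum N.+1 (fun I => (Theta_plus I l.+1)%:Z).
  by move=> lN; rewrite tadpole_sum_wsum subnK.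
have sumE i j : (j <= N.+1)%N ->
    \sum_(i.+1 <= k < j.+1) wsum elem_sum N.+1 (fun I => (Theta_plus I k)%:Z) =
    \sum_(i <= l < j) tadpole_sum (N - l) l.
  move=> jN; rewrite big_add1 /=; apply: eq_big_nat => l /andP[_ lj].
  by rewrite TE //; lia.
have -> : (b.+1 + c.+1 = (b + c).+1.+1)%N by lia.
rewrite !sumE; try lia.
(* The third path is shrunk to an edge; after a rotation the path with [b + c] inner vertices is
   shrunk too, leaving a cycle. That cycle is the term [l = 0], and the term [l = N] is a loop,
   hence zero. *)
rewrite (theta_sum_reduce (erefl N)) (theta_sum_rot a).
rewrite (@theta_sum_reduce N) ?addnA // theta_sum_cycle.
rewrite [\sum_(0 <= l < _) _]big_ltn // subn0.
rewrite [\sum_(a.+1 <= l < N.+1) _]big_nat_recr /=; last by lia.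
by rewrite subnn tadpole_sum_loop /N; ring.
Qed.

End Transfer.

(** * Proper colourings of the theta graph *)

Section ThetaColorings.
Variables (C : finType) (R : comNzRingType) (x : C -> R).

Definition is_proper (V : finType) (adj : rel V) (kappa : V -> C) :=
  [forall u, forall v, adj u v ==> (kappa u != kappa v)].

Local Notation neq := (fun u v : C => u != v).

Lemma walk_tuple l u v :
  (\sum_(t : l.-tuple C | path neq u (rcons t v)) \prod_(i <- t) x i = walk x l u v)%R.
Proof.
elim: l u => [|l IH] u.
  rewrite big_mkcond (big_pred1 [tuple]) /=; last by move=> t; apply/esym/eqP/tuple0.
  by rewrite andbT big_nil; case: (u != v).
rewrite (reindex (fun p : C * l.-tuple C => [tuple of p.1 :: p.2])) /=; last first.
  exists (fun t : l.+1.-tuple C => (thead t, [tuple of behead t])) => [[w t] _|t _].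
    by congr pair; apply: val_inj.
  by rewrite [RHS]tuple_eta; apply: val_inj.
rewrite -(pair_big_dep (fun w => u != w) (fun w t => path neq w (rcons (val t) v))
  (fun w (t : l.-tuple C) => \prod_(i <- w :: t) x i)%R) /=.
apply: eq_big => w; first by rewrite eq_sym.
move=> _; rewrite -IH big_distrr; apply: eq_bigr => t _ /=.
by rewrite big_cons.
Qed.

Lemma path_consecutive (V : eqType) (e : rel C) (kappa : V -> C) (y : V) (s : seq V) :
  path e (kappa y) (map kappa s) =
  all (fun p => e (kappa p.1) (kappa p.2)) (zip (y :: s) s).
Proof. by elim: s y => //= z s IH y; rewrite IH. Qed.

Lemma proper_theta a b c (kappa : theta_vertex a b c -> C) :
  is_proper (@theta_adj a b c) kappa =
  all (fun s => path neq (head (kappa (inl false)) (map kappa s)) (behead (map kappa s)))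
    (theta_paths a b c).
Proof.
apply/forallP/allP => [prop s sP|prop u].
  have hd : map kappa s = kappa (inl false) :: map kappa (behead s).
    by move: sP; rewrite !inE => /or3P[] /eqP->.
  have hs : s = inl false :: behead s by move: sP; rewrite !inE => /or3P[] /eqP->.
  rewrite hd /= path_consecutive -hs; apply/allP => -[u v] uv /=.
  have /forallP/(_ v)/implyP := prop u; apply; apply/hasP; exists s => //.
  by rewrite /consecutive uv.
have key s u' v' : s \in theta_paths a b c -> consecutive s u' v' -> kappa u' != kappa v'.
  move=> sP; have := prop s sP.
  have hd : map kappa s = kappa (inl false) :: map kappa (behead s).
    by move: sP; rewrite !inE => /or3P[] /eqP->.
  have hs : s = inl false :: behead s by move: sP; rewrite !inE => /or3P[] /eqP->.
  by rewrite hd /= path_consecutive -hs => /allP h /h.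
apply/forallP => v; apply/implyP => /hasP[s sP /orP[/(key _ _ _ sP)//|/(key _ _ _ sP)]].
by rewrite eq_sym.
Qed.

Lemma chrom_theta_sum a b c :
  (\sum_(kappa : {ffun theta_vertex a b c -> C} | is_proper (@theta_adj a b c) kappa)
     \prod_v x (kappa v) = theta_sum x a.-1 b.-1 c.-1)%R.
Proof.
(* The colours of the terminals are split off because, once they are fixed, the three paths are
   coloured independently. *)
pose T := ((C * C) * (a.-1.-tuple C * (b.-1.-tuple C * c.-1.-tuple C)))%type.
pose K (p : T) : {ffun theta_vertex a b c -> C} := [ffun w =>
  match w with
  | inl t => if t then p.1.2 else p.1.1
  | inr (inl i) => tnth p.2.1 i
  | inr (inr (inl i)) => tnth p.2.2.1 i
  | inr (inr (inr i)) => tnth p.2.2.2 i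
  end].
pose K' (k : {ffun theta_vertex a b c -> C}) : T :=
  ((k (inl false), k (inl true)), ([tuple k (inr (inl i)) | i < a.-1],
   ([tuple k (inr (inr (inl i))) | i < b.-1], [tuple k (inr (inr (inr i))) | i < c.-1]))).
rewrite (reindex K) /=; last first.
  exists K' => [[[u v] [ta [tb tc]]] _|k _].
    rewrite /K' !ffunE /=; congr (_, (_, (_, _))); apply: eq_from_tnth => i;
    by rewrite tnth_mktuple ffunE.
  by apply/ffunP => -[[]|[i|[i|i]]]; rewrite ffunE /= ?tnth_mktuple.
have pathE l (f : 'I_l.-1 -> theta_vertex a b c) (p : T) (t : l.-1.-tuple C) :
    (forall i, K p (f i) = tnth t i) ->
    path neq (head (K p (inl false)) (map (K p) (theta_path f)))
      (behead (map (K p) (theta_path f))) = path neq p.1.1 (rcons t p.1.2).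
  move=> ft; rewrite /= map_rcons !ffunE /= -map_comp.
  by rewrite (eq_map (g := tnth t)) // map_tnth_enum.
rewrite (eq_bigl (fun p : T => [&& path neq p.1.1 (rcons p.2.1 p.1.2),
    path neq p.1.1 (rcons p.2.2.1 p.1.2) & path neq p.1.1 (rcons p.2.2.2 p.1.2)])); last first.
  move=> p; rewrite proper_theta [LHS]/= andbT.
  by congr [&& _, _ & _]; apply: pathE => i; rewrite ffunE.
rewrite (eq_bigr (fun p : T => x p.1.1 * x p.1.2 * (\prod_(i <- p.2.1) x i *
   (\prod_(i <- p.2.2.1) x i * \prod_(i <- p.2.2.2) x i))))%R; last first.
  move=> p _; rewrite big_sumType big_bool /= !ffunE /=.
  congr (_ * _)%R; first exact: mulrC.
  rewrite big_sumType /=; congr (_ * _)%R.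
    by rewrite big_tuple; apply: eq_bigr => i _; rewrite ffunE.
  rewrite big_sumType /=; congr (_ * _)%R;
    by rewrite big_tuple; apply: eq_bigr => i _; rewrite ffunE.
pose Q := (a.-1.-tuple C * (b.-1.-tuple C * c.-1.-tuple C))%type.
rewrite -(pair_big_dep xpredT (fun (uv : C * C) (q : Q) => [&& path neq uv.1 (rcons q.1 uv.2),
    path neq uv.1 (rcons q.2.1 uv.2) & path neq uv.1 (rcons q.2.2 uv.2)])
  (fun (uv : C * C) (q : Q) => x uv.1 * x uv.2 * (\prod_(i <- q.1) x i *
   (\prod_(i <- q.2.1) x i * \prod_(i <- q.2.2) x i)))%R).
rewrite /theta_sum pair_big /=; apply: eq_bigr => -[u v] _ /=.
rewrite -big_distrr /=; congr (_ * _)%R; rewrite -mulrA -!walk_tuple.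
rewrite [X in (_ * X)%R]big_distrlr pair_big /= big_distrlr pair_big /=.
by apply: eq_bigl.
Qed.

End ThetaColorings.

(** * Truncation to finitely many variables *)

Section Truncation.
Local Open Scope classical_set_scope.
Local Open Scope ring_scope.

Lemma monomial_sumE (T : choiceType) (A : set T) (mon : T -> {cmonom nat})
    (T' : finType) (P : pred T') (h : T' -> T) (m : {cmonom nat}) :
    injective h -> (forall t, P t <-> A (h t)) ->
    (forall t, A t -> mon t = m -> exists t', h t' = t) ->
  monomial_sum A mon m = \sum_(t | P t) (mon (h t) == m)%:R.
Proof.
move=> hinj hP hex; rewrite /monomial_sum.
rewrite (fsbigE [seq h t | t <- enum T' & P t && (mon (h t) == m)]).
- rewrite [RHS](eq_bigr (fun t => if mon (h t) == m then 1 else 0)); last first.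
    by move=> t _; case: eqP.
  rewrite -big_mkcondr big_map big_filter_cond big_enum_cond /=.
  apply: eq_bigl => t; case: (boolP (P t)) => //= Pt; case: eqP => //= tm.
  by apply/mem_set; split => //; apply/hP.
- by rewrite map_inj_uniq // filter_uniq // enum_uniq.
- move=> _ /mapP[t + ->]; rewrite mem_filter => /andP[/andP[Pt /eqP tm] _].
  by split=> //; apply/hP.
move=> t [At tm]; have [t' t't] := hex t At tm; case/mapP; exists t' => //.
by rewrite mem_filter mem_enum t't tm eqxx !andbT; apply/hP; rewrite t't.
Qed.

Variable N : nat.

Definition trunc_var (i : 'I_N) : {malg int[{cmonom nat}]} := << ucm (val i) >>.

Definition bounded_monom (m : {cmonom nat}) := {in finsupp m, forall i, (i < N)%N}.

(** Comparing only monomials in the first [N] variables amounts to setting the other variables to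
    zero. *)
Definition agree (f : series) (F : {malg int[{cmonom nat}]}) :=
  forall m, bounded_monom m -> f m = F@_m.

Lemma prod_monom (T : Type) (r : seq T) (P : pred T) (g : T -> {cmonom nat}) :
  \prod_(i <- r | P i) (<< g i >> : {malg int[{cmonom nat}]}) =
  << \big[mmul/mone]_(i <- r | P i) g i >>.
Proof.
elim/big_rec2: _ => [|i m p _ ->]; first by rewrite -mpolyC1E.
by rewrite malgM_def fgmulUU mulr1.
Qed.

Lemma agree_monomial_sum (T : choiceType) (A : set T) (mon : T -> {cmonom nat})
    (T' : finType) (P : pred T') (h : T' -> T) :
    injective h -> (forall t, P t <-> A (h t)) ->
    (forall t, A t -> bounded_monom (mon t) -> exists t', h t' = t) ->
  agree (monomial_sum A mon) (\sum_(t | P t) << mon (h t) >>).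
Proof.
move=> hinj hP hex m mN; rewrite (monomial_sumE hinj hP) => [|t At tm].
  by rewrite raddf_sum; apply: eq_bigr => t _; rewrite /= mcoeffU1.
by apply: hex => //; rewrite tm.
Qed.

Lemma bounded_monomM (m m' : {cmonom nat}) :
  bounded_monom (mmul m m') -> bounded_monom m /\ bounded_monom m'.
Proof.
by move=> mm; split=> i im; apply: mm; rewrite mdomD in_fsetU im ?orbT.
Qed.

Lemma bounded_monom_prod (T : eqType) (r : seq T) (g : T -> nat) :
  bounded_monom (\big[mmul/mone]_(i <- r) ucm (g i)) ->
  {in r, forall i, (g i < N)%N}.
Proof.
elim: r => // j r IH; rewrite big_cons => /bounded_monomM[h /IH h'] i.
by rewrite inE => /predU1P[->|/h'//]; apply: h; rewrite mdomU in_fset1.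
Qed.

Lemma agree_chromsym (V : finType) (adj : rel V) :
  agree (chromsym adj)
    (\sum_(kappa : {ffun V -> 'I_N} | is_proper adj kappa) \prod_v trunc_var (kappa v)).
Proof.
under eq_bigr => kappa _ do rewrite prod_monom.
pose h (k : {ffun V -> 'I_N}) : {ffun V -> nat} := [ffun v => val (k v)].
under eq_bigr => kappa _.
  rewrite (eq_bigr (fun v => ucm (h kappa v))); last by move=> v _; rewrite ffunE.
  over.
apply: (agree_monomial_sum (h := h)) => [k k' /ffunP kk|k|k _ kN].
- by apply/ffunP => v; apply: val_inj; have := kk v; rewrite !ffunE.
- split=> [/forallP pk u v uv|pk].
    by have /forallP/(_ v)/implyP/(_ uv)/eqP := pk u; rewrite !ffunE => h1 /val_inj.
  apply/forallP => u; apply/forallP => v; apply/implyP => uv; apply/eqP => e.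
  by apply: (pk u v uv); rewrite !ffunE e.
have kN' v : (k v < N)%N by apply: (bounded_monom_prod kN); rewrite mem_index_enum.
by exists [ffun v => Ordinal (kN' v)]; apply/ffunP => v; rewrite !ffunE.
Qed.

Lemma agree_elem k : agree (elem k) (elem_sum trunc_var k).
Proof.
rewrite /elem_sum; under eq_bigr => S _ do rewrite prod_monom.
pose h (S : {set 'I_N}) : {fset nat} := seq_fset tt (map val (enum S)).
have hp S : perm_eq (h S) (map val (enum S)).
  apply: uniq_perm; first exact: fset_uniq.
    by rewrite map_inj_uniq ?enum_uniq //; apply: val_inj.
  by move=> i; rewrite seq_fsetE.
under eq_bigr => S _.
  rewrite (_ : \big[mmul/mone]_(i in S) _ = \big[mmul/mone]_(i <- h S) ucm i); last first.
    by rewrite (perm_big _ (hp S)) big_map big_enum.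
  over.
apply: (agree_monomial_sum (h := h)) => [S S' SS|S|S Sk SN].
- apply/setP => i; have := perm_mem (hp S) (val i); rewrite SS (perm_mem (hp S')).
  by rewrite !mem_map ?mem_enum //; apply: val_inj.
- rewrite /= (perm_size (hp S)) size_map -cardE; split=> /eqP //.
have SN' := bounded_monom_prod SN.
exists (finset (fun i : 'I_N => val i \in S)); apply/fsetP => i.
rewrite (perm_mem (hp _)); apply/mapP/idP => [[j]|iS].
  by rewrite mem_enum inE => jS ->.
by exists (Ordinal (SN' i iS)); rewrite // mem_enum inE.
Qed.

(** Factors of a bounded monomial are bounded, so only coefficients on which the factors agree are
    multiplied. *)
Lemma agree_psmul f g F G : agree f F -> agree g G -> agree (psmul f g) (F * G).
Proof.
move=> fF gG m mN; rewrite /psmul mcoeffMl.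
rewrite (@eq_fsbigr _ _ _ _ _ (fun d => F@_d.1 * G@_d.2)); last first.
  by move=> d; rewrite inE /= => dm; rewrite fF ?gG //; move: mN; rewrite -dm => /bounded_monomM[].
pose r := [seq d <- [seq (d1, d2) | d1 <- msupp F, d2 <- msupp G] | mmul d.1 d.2 == m].
rewrite (fsbigE r).
- rewrite big_filter_cond /= big_mkcond big_allpairs /=; apply: eq_bigr => d1 _.
  apply: eq_bigr => d2 _; case: eqP => dm; rewrite ?mulr1n ?mulr0n ?andbF ?andbT //.
  by rewrite ifT // inE.
- apply/filter_uniq/allpairs_uniq; [exact: fset_uniq|exact: fset_uniq|].
  by move=> [d1 d2] [d1' d2'] _ _ /= [-> ->].
- by move=> d; rewrite /= mem_filter => /andP[/eqP].
move=> [d1 d2] /= dm; rewrite mem_filter /= dm eqxx /= => dr.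
have [d1F|/mcoeff_outdom ->] := boolP (d1 \in msupp F); last by rewrite mul0r.
have [d2G|/mcoeff_outdom ->] := boolP (d2 \in msupp G); last by rewrite mulr0.
by case/negP: dr; apply/allpairsP; exists (d1, d2).
Qed.

Lemma agree_elemI I : agree (elemI I) (eprod (elem_sum trunc_var) I).
Proof.
rewrite /elemI /eprod; elim: I => [|i I IH].
  by rewrite !big_nil => m _; rewrite mcoeff1.
by rewrite !big_cons; apply: agree_psmul => //; apply: agree_elem.
Qed.

End Truncation.

Local Open Scope nat_scope.
Local Open Scope classical_set_scope.
Local Open Scope ring_scope.

Lemma mulrz_fctE (T : Type) (f : T -> int) (z : int) t : (f *~ z) t = f t *~ z.
Proof.
by case: z => n; rewrite ?NegzE ?mulrNz -?pmulrn ?opprfctE natmulfctE.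
Qed.

Theorem theorem3p2 (a b c n : nat)
    (hab : (b <= a)%N) (hbc : (c <= b)%N) (hc : (1 <= c)%N) (hb : (2 <= b)%N)
    (hn : n = (a + b + c - 1)%N) :
  chromsym (@theta_adj a b c) =
  \sum_(I \in compositions n) elemI I *~ (theta_coef a b c I * (weight I)%:Z).
Proof.
apply: funext => m.
(* Coefficients are compared one at a time: with [N] above every variable index in [m], truncation
   keeps the coefficient of [m]. *)
have [N mN] : exists N, bounded_monom N m.
  exists (\max_(i <- finsupp m) i.+1)%N => i im.
  by rewrite (big_rem _ im) /= leq_maxl.
rewrite (agree_chromsym _ mN) chrom_theta_sum theta_sum_wsum.
rewrite !prednK ?(leq_trans hc) ?(leq_trans _ hab) ?(leq_trans hc hbc) //.
rewrite fsbig_finite; last exact: compositions_finite.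
rewrite fct_sumE -hn /wsum raddf_sum; apply: eq_bigr => I _ /=.
by rewrite mulrz_fctE (agree_elemI _ mN) raddfMz.
Qed.
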